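(* Let $F$ be a field of characteristic not $2$, let $a\in F^*$ be a non-square, and let $L=F(\sqrt{a})$. Then the Galois closure $\overline{L^{(3)}}$ of $L^{(3)}$ over $F$ is contained in $F^{(5)}$.
   Context: All fields are taken inside a fixed quadratic closure $F_q$ of $F$ (the compositum of all finite Galois extensions of $F$ of $2$-power degree, equivalently the smallest quadratically closed extension of $F$). For a field $K$ of characteristic not $2$ (inside $F_q$), define $K^{(1)}=K$ and, for $n\ge 1$, $K^{(n+1)}$ is the compositum of all quadratic extensions of $K^{(n)}$ which are Galois over $K$. For an extension $M/F$ inside $F_q$, $\overline{M}$ denotes the Galois closure of $M$ over $F$. *)

(* Defs.v *)
(* All fields are subfields (Prop-valued predicates) of an
   ambient field Om, which is assumed quadratically closed of char <> 2 in the
   theorem, so it contains a (unique) quadratic closure F_q of F. *)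
From HB Require Import structures.
From mathcomp Require Import all_boot all_order all_algebra all_field.
Set Implicit Arguments. Unset Strict Implicit. Unset Printing Implicit Defensive.
Import GRing.Theory.
Local Open Scope ring_scope.

Section Defs.
Variable Om : fieldType.

Definition is_subfield (K : Om -> Prop) : Prop :=
  [/\ K 0, K 1, (forall x y, K x -> K y -> K (x - y)),
      (forall x y, K x -> K y -> K (x * y)) & (forall x, K x -> K x^-1)].

Definition subfam (A B : Om -> Prop) : Prop := forall x, A x -> B x.

Definition generated (S : Om -> Prop) : Om -> Prop :=
  fun x => forall E, is_subfield E -> subfam S E -> E x.

Definition adjoin (K : Om -> Prop) (y : Om) : Om -> Prop :=
  generated (fun x => K x \/ x = y).

Definition quad_ext (E E' : Om -> Prop) : Prop :=
  [/\ is_subfield E', subfam E E' &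
      exists y, [/\ E' y, ~ E y &
        forall z, E' z -> exists a b, [/\ E a, E b & z = a + b * y]]].

Definition poly_over (K : Om -> Prop) (p : {poly Om}) : Prop :=
  forall i, K p`_i.

Definition splits_in (E : Om -> Prop) (p : {poly Om}) : Prop :=
  exists rs : seq Om, (forall r, r \in rs -> E r) /\
    p = lead_coef p *: \prod_(r <- rs) ('X - r%:P).

Definition galois_over (K E : Om -> Prop) : Prop :=
  [/\ is_subfield E, subfam K E &
      forall x, E x -> exists p : {poly Om},
        [/\ p != 0, poly_over K p, root p x, separable_poly p & splits_in E p]].

Definition qstep (K E : Om -> Prop) : Om -> Prop :=
  generated (fun x => E x \/ exists E', [/\ quad_ext E E', galois_over K E' & E' x]).

(* K^(n): K^(1) = K, K^(n+1) = qstep K K^(n). (K^(0) := K as a dummy.) *)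
Definition kpow (K : Om -> Prop) (n : nat) : Om -> Prop :=
  iter n.-1 (qstep K) K.

Definition gal_closure (F M : Om -> Prop) : Om -> Prop :=
  fun x => forall N, subfam M N -> galois_over F N -> N x.

End Defs.

(* Main.v *)
(**
   Let Q be the closure of F under square roots, and let G_K be the monoid of
   K-embeddings Q -> Q.  By Zorn's lemma square roots can be conjugated, so the
   fixed field of G_K is K; orbits are finite, so an intermediate field E is
   Galois over K exactly when G_K preserves it, and a square root s of an element
   of E lies in the next step of the tower over K when G_K multiplies s by
   elements of E.

   Let M = L^(n), let s be a generator of L^(n+1) with s^2 in M, and let tau in
   G_F satisfy tau(y) = -y.  Every element of G_F sends s into M s or M tau(s),
   and symmetrically for tau(s), so it multiplies w = s tau(s) by an element of M.
   If M is contained in F^(m), then w is in F^(m+1), and modulo w the conjugates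
   of s are multiples of s, so s is in F^(m+2).  For n = 1 the square of w is a
   norm from L to F, so w is already in F^(2), where L lies, and one step is
   saved: L^(2) is in F^(3) and L^(3) is in F^(5), which is Galois over F.
*)
Require Import Defs.
From HB Require Import structures.
From mathcomp Require Import all_boot all_order all_algebra all_field.
From mathcomp Require Import boolp classical_sets.
From mathcomp Require Import ring.
Set Implicit Arguments. Unset Strict Implicit. Unset Printing Implicit Defensive.

Import GRing.Theory.
Local Open Scope ring_scope.

(** * Zorn's lemma for families of subsets *)

Lemma Zorn_from (T : Type) (P : (T -> Prop) -> Prop) (A0 : T -> Prop) :
  P A0 ->
  (forall C : (T -> Prop) -> Prop, (exists X, C X) -> (forall X, C X -> P X) ->
     (forall X Y, C X -> C Y -> (forall t, X t -> Y t) \/ (forall t, Y t -> X t)) ->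
     P (fun t => exists2 X, C X & X t)) ->
  exists2 A, P A & forall B, P B -> (forall t, A t -> B t) -> forall t, B t -> A t.
Proof.
move=> PA0 Pchain.
have [C CP totC|A [PA maxA]] := @Zorn_bigcup T (fun X => X = set0 \/ P X).
  have [[X CX [t Xt]]|noX] := pselect (exists2 X, C X & exists t, X t); last first.
    left; apply/seteqP; split=> // t [X CX Xt].
    by case: noX; exists X => //; exists t.
  (* Dropping the empty member of the chain keeps the union and leaves only sets satisfying [P]. *)
  pose D Y := C Y /\ Y <> set0.
  have DX : D X by split=> // X0; rewrite X0 in Xt.
  right.
  suff -> : (\bigcup_(Y in C) Y)%classic = (fun t => exists2 Y, D Y & Y t).
    apply: Pchain; first by exists X.
      by move=> Y [/CP[] // ->].
    by move=> Y Z [CY _] [CZ _]; apply: totC.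
  apply/seteqP; split=> [u [Y CY Yu]|u [Y [CY _] Yu]]; last by exists Y.
  by exists Y => //; split=> // Y0; rewrite Y0 in Yu.
have max B : P B -> (forall t, A t -> B t) -> forall t, B t -> A t.
  move=> PB AB; apply: contrapT => nBA.
  by apply: (maxA B); [split | right].
case: PA => [A0E|PA]; last by exists A.
exists A0 => // B PB _ t Bt.
by exfalso; have := max B PB _ t Bt; rewrite A0E; apply.
Qed.

(** * Subfields and adjunction of a square root *)

Section Subfields.
Variable Om : fieldType.
Implicit Types (E K S : Om -> Prop) (x y z s t : Om).

Section Closure.
Variables (E : Om -> Prop) (sfE : is_subfield E).

Lemma sf0 : E 0. Proof. by case: sfE. Qed.
Lemma sf1 : E 1. Proof. by case: sfE. Qed.
Lemma sfB x y : E x -> E y -> E (x - y). Proof. by case: sfE => _ _ + _ _; apply. Qed.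
Lemma sfM x y : E x -> E y -> E (x * y). Proof. by case: sfE => _ _ _ + _; apply. Qed.
Lemma sfV x : E x -> E x^-1. Proof. by case: sfE => _ _ _ _; apply. Qed.
Lemma sfN x : E x -> E (- x).
Proof. by move=> Ex; rewrite -sub0r; apply: sfB => //; exact: sf0. Qed.
Lemma sfD x y : E x -> E y -> E (x + y).
Proof. by move=> Ex Ey; rewrite -[y]opprK; apply: sfB => //; exact: sfN. Qed.
Lemma sfX x n : E x -> E (x ^+ n).
Proof.
move=> Ex; elim: n => [|n IHn]; first by rewrite expr0; exact: sf1.
by rewrite exprS; exact: sfM.
Qed.

End Closure.

Lemma generated_subfield S : is_subfield (generated S).
Proof.
split=> [E sfE _|E sfE _|x y Sx Sy E sfE SE|x y Sx Sy E sfE SE|x Sx E sfE SE].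
- exact: sf0.
- exact: sf1.
- by apply: sfB => //; [exact: Sx | exact: Sy].
- by apply: sfM => //; [exact: Sx | exact: Sy].
- by apply: sfV => //; exact: Sx.
Qed.

Lemma sub_generated S : subfam S (generated S).
Proof. by move=> x Sx E _; apply. Qed.

Definition sqrt_adjoin E s : Om -> Prop :=
  fun z => exists a b, [/\ E a, E b & z = a + b * s].

Lemma sub_sqrt_adjoin E s : is_subfield E -> subfam E (sqrt_adjoin E s).
Proof. by move=> sfE x Ex; exists x, 0; split=> //; [exact: sf0 | rewrite mul0r addr0]. Qed.

Lemma mem_sqrt_adjoin E s : is_subfield E -> sqrt_adjoin E s s.
Proof. by move=> sfE; exists 0, 1; split; [exact: sf0 | exact: sf1 | rewrite mul1r add0r]. Qed.

Lemma invr_conj (a b s : Om) : a + b * s != 0 -> a ^+ 2 - b ^+ 2 * s ^+ 2 != 0 ->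
  (a + b * s)^-1 = a / (a ^+ 2 - b ^+ 2 * s ^+ 2) - b / (a ^+ 2 - b ^+ 2 * s ^+ 2) * s.
Proof.
by move=> nz1 nz2; field; rewrite exprMn nz1 nz2.
Qed.

(** The norm factors as [(a + b * s) * (a - b * s)]; if the second factor vanished with [b] nonzero,
    [s = a / b] would lie in [E]. *)
Lemma norm_sqrt_neq0 E s a b : is_subfield E -> ~ E s -> E a -> E b ->
  a + b * s != 0 -> a ^+ 2 - b ^+ 2 * s ^+ 2 != 0.
Proof.
move=> sfE nEs Ea Eb nz; apply/eqP => N0.
have [b0|nzb] := eqVneq b 0.
  by move: N0 nz; rewrite b0 mul0r addr0 expr0n mul0r subr0 => /eqP; rewrite sqrf_eq0 => ->.
have: (a + b * s) * (a - b * s) = 0 by rewrite -N0; ring.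
move/eqP; rewrite mulf_eq0 (negPf nz) /= subr_eq0 => /eqP aE.
case: nEs; have -> : s = a / b by rewrite aE mulrC mulKf.
by apply: sfM => //; exact: sfV.
Qed.

Lemma sqrt_adjoin_subfield E s : is_subfield E -> E (s ^+ 2) ->
  is_subfield (sqrt_adjoin E s).
Proof.
move=> sfE Es2; split.
- by apply: sub_sqrt_adjoin => //; exact: sf0.
- by apply: sub_sqrt_adjoin => //; exact: sf1.
- move=> _ _ [a [b [Ea Eb ->]]] [c [d [Ec Ed ->]]].
  by exists (a - c), (b - d); split; [exact: sfB | exact: sfB | ring].
- move=> _ _ [a [b [Ea Eb ->]]] [c [d [Ec Ed ->]]].
  exists (a * c + b * d * s ^+ 2), (a * d + b * c); split; last by ring.
    by apply: (sfD sfE (sfM sfE Ea Ec) (sfM sfE (sfM sfE Eb Ed) Es2)).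
  by apply: (sfD sfE (sfM sfE Ea Ed) (sfM sfE Eb Ec)).
- move=> _ [a [b [Ea Eb ->]]].
  (* For [s] in [E] the norm of a nonzero [a + b * s] may vanish, so this case cannot use the
     conjugate formula. *)
  have [Es|nEs] := pselect (E s).
    by apply: sub_sqrt_adjoin => //; apply: sfV => //; apply: sfD => //; exact: sfM.
  have [->|nz] := eqVneq (a + b * s) 0.
    by rewrite invr0; apply: sub_sqrt_adjoin => //; exact: sf0.
  have nzN := norm_sqrt_neq0 sfE nEs Ea Eb nz.
  have EN : E (a ^+ 2 - b ^+ 2 * s ^+ 2)^-1.
    by apply: sfV => //; apply: sfB => //; [exact: sfX | apply: sfM => //; exact: sfX].
  rewrite (invr_conj nz nzN).
  exists (a / (a ^+ 2 - b ^+ 2 * s ^+ 2)), (- (b / (a ^+ 2 - b ^+ 2 * s ^+ 2))).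
  split; [exact: sfM | by apply: sfN => //; exact: sfM | by rewrite mulNr].
Qed.

Lemma quad_ext_sqrt_adjoin E s : is_subfield E -> E (s ^+ 2) -> ~ E s ->
  quad_ext E (sqrt_adjoin E s).
Proof.
move=> sfE Es2 nEs; split; first exact: sqrt_adjoin_subfield.
  exact: sub_sqrt_adjoin.
by exists s; split=> //; exact: mem_sqrt_adjoin.
Qed.

(** Completing the square: if [y ^+ 2 = c + d * y], then [y - d / 2] has its square in [E] and
    generates the same extension. *)
Lemma quad_ext_sqrt E E' : (2%:R : Om) != 0 -> is_subfield E -> quad_ext E E' ->
  exists s, [/\ E' s, ~ E s, E (s ^+ 2) & subfam E' (sqrt_adjoin E s)].
Proof.
move=> nz2 sfE [sfE' EE' [y [E'y nEy gen]]].
have [c [d [Ec Ed y2]]] := gen _ (sfX sfE' 2 E'y).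
have E2 : E 2%:R^-1 by apply: sfV => //; apply: sfD => //; exact: sf1.
have Ed2 : E (d / 2%:R) by exact: sfM.
exists (y - d / 2%:R); split.
- by apply: sfB => //; exact: EE'.
- by move=> /sfD - /(_ sfE _ Ed2); rewrite subrK.
- have -> : (y - d / 2%:R) ^+ 2 = c + (d / 2%:R) ^+ 2.
    have -> : (y - d / 2%:R) ^+ 2 = y ^+ 2 - d * y + (d / 2%:R) ^+ 2 by field.
    by rewrite y2; ring.
  by apply: sfD => //; exact: sfX.
- move=> z /gen[a [b [Ea Eb ->]]]; exists (a + b * (d / 2%:R)), b; split=> //.
    by apply: sfD => //; exact: sfM.
  by ring.
Qed.

End Subfields.

(** * The quadratic closure of [F] inside [Om] *)

Section QuadraticClosure.
Variables (Om : fieldType) (F : Om -> Prop).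
Hypothesis nz2 : (2%:R : Om) != 0.
Hypothesis sqrtOm : forall x : Om, exists z : Om, z ^+ 2 = x.
Hypothesis sfF : is_subfield F.
Implicit Types (E K M : Om -> Prop) (x y z s t : Om) (sigma tau rho : Om -> Om).

Definition sqrt_closed E := forall z, E (z ^+ 2) -> E z.

(** The intersection form is an induction principle: a property holds on all of the closure once it
    cuts out a subfield that contains [F] and is closed under square roots. *)
Definition qclosure : Om -> Prop :=
  fun x => forall E, is_subfield E -> subfam F E -> sqrt_closed E -> E x.

Local Notation Q := qclosure.

Lemma qclosure_subfield : is_subfield Q.
Proof.
split=> [E sfE _ _|E sfE _ _|x y Qx Qy E sfE FE rE|x y Qx Qy E sfE FE rE|x Qx E sfE FE rE].
- exact: sf0.
- exact: sf1.
- by apply: sfB => //; [exact: Qx | exact: Qy].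
- by apply: sfM => //; [exact: Qx | exact: Qy].
- by apply: sfV => //; exact: Qx.
Qed.
Local Notation sfQ := qclosure_subfield.

Lemma sub_qclosure : subfam F Q.
Proof. by move=> x Fx E _ FE _; exact: FE. Qed.

Lemma qclosure_sqrt_closed : sqrt_closed Q.
Proof. by move=> z Qz E sfE FE rE; apply: (rE); exact: Qz. Qed.

(** * Embeddings of [Q] and conjugation of square roots *)

(** A total map on [Om] constrained only on [K] and [Q], so computations with it carry membership in
    [Q] along. *)
Definition embedding K sigma : Prop :=
  [/\ forall x, K x -> sigma x = x,
      forall x, Q x -> Q (sigma x),
      forall x y, Q x -> Q y -> sigma (x - y) = sigma x - sigma y &
      forall x y, Q x -> Q y -> sigma (x * y) = sigma x * sigma y].

(* Graphs of the partial K-embeddings of [Q] whose domain is a field: subfields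
   of [Om * Om] containing the diagonal of [K], with [g (0, y)] only for [y = 0]. *)
Definition partial_graph K (g : Om * Om -> Prop) : Prop :=
  (forall x, K x -> g (x, x)) /\
  [/\ forall x x', g (x, x') -> Q x /\ Q x',
      forall x x' y y', g (x, x') -> g (y, y') -> g (x - y, x' - y'),
      forall x x' y y', g (x, x') -> g (y, y') -> g (x * y, x' * y'),
      forall x x', g (x, x') -> g (x^-1, x'^-1) &
      forall y, g (0, y) -> y = 0].

Definition extend_graph (g : Om * Om -> Prop) t t' : Om * Om -> Prop :=
  fun p => exists a a' b b', [/\ g (a, a'), g (b, b') & p = (a + b * t, a' + b' * t')].

Definition graph_dom (g : Om * Om -> Prop) : Om -> Prop := fun x => exists y, g (x, y).

Lemma graph_dom_subfield K g : is_subfield K -> partial_graph K g ->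
  is_subfield (graph_dom g).
Proof.
move=> sfK [gK [_ gB gM gV _]]; split.
- by exists 0; apply: gK; exact: sf0.
- by exists 1; apply: gK; exact: sf1.
- by move=> x y [x' gx] [y' gy]; exists (x' - y'); exact: gB.
- by move=> x y [x' gx] [y' gy]; exists (x' * y'); exact: gM.
- by move=> x [x' gx]; exists (x'^-1); exact: gV.
Qed.

(** The extension sends [t] to [t']. As [t] is outside the domain, [a + b * t = 0] forces
    [a = b = 0], which makes it well defined; inverses are computed with the norm on both sides. *)
Lemma partial_graph_extend K g t t' : is_subfield K -> partial_graph K g ->
  g (t ^+ 2, t' ^+ 2) -> ~ graph_dom g t -> partial_graph K (extend_graph g t t').
Proof.
move=> sfK pg gt ndt.
have sfdom := graph_dom_subfield sfK pg.
case: pg => gK [gQ gB gM gV g0].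
have g00 : g (0, 0) by apply: gK; exact: sf0.
have g11 : g (1, 1) by apply: gK; exact: sf1.
have gN x x' : g (x, x') -> g (- x, - x').
  by move=> gx; rewrite -[- x]sub0r -[- x']sub0r; exact: gB.
have gD x x' y y' : g (x, x') -> g (y, y') -> g (x + y, x' + y').
  by move=> gx gy; rewrite -[y]opprK -[y']opprK; apply: gB => //; exact: gN.
have [Qt2 Qt'2] := gQ _ _ gt.
have Qt := qclosure_sqrt_closed Qt2; have Qt' := qclosure_sqrt_closed Qt'2.
have ge0 y : extend_graph g t t' (0, y) -> y = 0.
  move=> [a [a' [b [b' [ga gb [abt ->]]]]]].
  have b0 : b = 0.
    apply: contrapT => /eqP nzb; apply: ndt.
    have -> : t = - a / b by rewrite -[- a]add0r {1}abt; field.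
    by exists (- a' / b'); apply: gM; [exact: gN | exact: gV].
  move: gb abt; rewrite b0 mul0r addr0 => /g0 -> a0.
  by move: ga; rewrite -a0 => /g0 ->; rewrite mul0r addr0.
split; first by move=> x /gK gx; exists x, x, 0, 0; rewrite !mul0r !addr0.
split=> //.
- move=> x x' [a [a' [b [b' [/gQ[Qa Qa'] /gQ[Qb Qb'] [-> ->]]]]]].
  split; exact: (sfD sfQ _ (sfM sfQ _ _)).
- move=> _ _ _ _ [a [a' [b [b' [ga gb [-> ->]]]]]] [c [c' [d [d' [gc gd [-> ->]]]]]].
  exists (a - c), (a' - c'), (b - d), (b' - d'); split; [exact: gB | exact: gB |].
  by congr pair; ring.
- move=> _ _ _ _ [a [a' [b [b' [ga gb [-> ->]]]]]] [c [c' [d [d' [gc gd [-> ->]]]]]].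
  exists (a * c + b * d * t ^+ 2), (a' * c' + b' * d' * t' ^+ 2).
  exists (a * d + b * c), (a' * d' + b' * c'); split; last by congr pair; ring.
    by apply: gD; [exact: gM | apply: (gM) => //; exact: gM].
  by apply: gD; exact: gM.
- move=> x x' gx; case: (gx) => [a [a' [b [b' [ga gb [xE x'E]]]]]].
  have [x0|nzx] := eqVneq x 0.
    move: (gx); rewrite x0 => /ge0 ->; rewrite invr0.
    by exists 0, 0, 0, 0; rewrite !mul0r !addr0.
  have gN2 : g (a ^+ 2 - b ^+ 2 * t ^+ 2, a' ^+ 2 - b' ^+ 2 * t' ^+ 2).
    by rewrite [a ^+ 2]expr2 [a' ^+ 2]expr2 [b ^+ 2]expr2 [b' ^+ 2]expr2;
      apply: gB; [exact: gM | apply: (gM) => //; exact: gM].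
  have nzN : a ^+ 2 - b ^+ 2 * t ^+ 2 != 0.
    by apply: (norm_sqrt_neq0 sfdom ndt); [exists a' | exists b' | rewrite -xE].
  (* A zero image of the nonzero norm would put [(1, 0)], hence [(0, -1)], into [g]. *)
  have nzN' : a' ^+ 2 - b' ^+ 2 * t' ^+ 2 != 0.
    apply/eqP => N'0; move: (gM _ _ _ _ gN2 (gV _ _ gN2)).
    rewrite N'0 mul0r mulfV // => /gB /(_ g11).
    by rewrite subrr sub0r => /g0/eqP; rewrite oppr_eq0 oner_eq0.
  have nzx' : x' != 0.
    apply: contra_neq nzN' => x'0.
    have -> : a' ^+ 2 - b' ^+ 2 * t' ^+ 2 = x' * (a' - b' * t') by rewrite x'E; ring.
    by rewrite x'0 mul0r.
  rewrite xE x'E (invr_conj _ nzN) -?xE // (invr_conj _ nzN') -?x'E //.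
  exists (a / (a ^+ 2 - b ^+ 2 * t ^+ 2)), (a' / (a' ^+ 2 - b' ^+ 2 * t' ^+ 2)).
  exists (- (b / (a ^+ 2 - b ^+ 2 * t ^+ 2))), (- (b' / (a' ^+ 2 - b' ^+ 2 * t' ^+ 2))).
  split; [by apply: (gM) => //; exact: gV | | by rewrite !mulNr].
  by apply: gN; apply: (gM) => //; exact: gV.
Qed.

(** The identity of [K] extends by [s] to [- s]; a maximal extension has a domain closed under
    square roots, since every element of [Om] has a root to serve as image. By minimality of [Q] the
    domain is all of [Q]. *)
Lemma embedding_sqrtN K s : is_subfield K -> subfam F K -> subfam K Q ->
  K (s ^+ 2) -> ~ K s -> exists2 sigma, embedding K sigma & sigma s = - s.
Proof.
move=> sfK FK KQ Ks2 nKs.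
pose g1 (p : Om * Om) := K p.1 /\ p.1 = p.2.
have pg1 : partial_graph K g1.
  split; first by move=> x Kx; split.
  split=> /=.
  - by move=> x x' [/= Kx <-]; split; exact: KQ.
  - by move=> x x' y y' [/= Kx <-] [/= Ky <-]; split=> //=; exact: sfB.
  - by move=> x x' y y' [/= Kx <-] [/= Ky <-]; split=> //=; exact: sfM.
  - by move=> x x' [/= Kx <-]; split=> //=; exact: sfV.
  - by move=> x' [/= _ <-].
pose g2 := extend_graph g1 s (- s).
have pg2 : partial_graph K g2.
  apply: partial_graph_extend => //; first by rewrite sqrrN; split.
  by move=> [y [/= /nKs]].
have g2s : g2 (s, - s).
  exists 0, 0, 1, 1; rewrite !mul1r !add0r.
  by split=> //; split=> //=; [exact: sf0 | exact: sf1].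
(* The pair [(s, - s)] is part of the predicate because the maximal graph need not contain [g2]. *)
have [C [X0 CX0] CP tot|g [pg gs] gmax] :=
    @Zorn_from _ (fun g => partial_graph K g /\ g (s, - s)) g2 (conj pg2 g2s).
  have [[X0K _] X0s] := CP _ CX0.
  have common (p q : Om * Om) X Y : C X -> C Y -> X p -> Y q -> exists2 Z, C Z & Z p /\ Z q.
    move=> CX CY Xp Yq; have [XY|YX] := tot _ _ CX CY.
      by exists Y => //; split=> //; exact: XY.
    by exists X => //; split=> //; exact: YX.
  split; last by exists X0.
  split; first by move=> x Kx; exists X0 => //; exact: X0K.
  split.
  - by move=> x x' [X CX Xx]; have [[_ [XQ _ _ _ _]] _] := CP _ CX; exact: XQ Xx.
  - move=> x x' y y' [X CX Xx] [Y CY Yy]; have [Z CZ [Zx Zy]] := common _ _ _ _ CX CY Xx Yy.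
    by have [[_ [_ ZB _ _ _]] _] := CP _ CZ; exists Z => //; exact: ZB.
  - move=> x x' y y' [X CX Xx] [Y CY Yy]; have [Z CZ [Zx Zy]] := common _ _ _ _ CX CY Xx Yy.
    by have [[_ [_ _ ZM _ _]] _] := CP _ CZ; exists Z => //; exact: ZM.
  - move=> x x' [X CX Xx].
    by have [[_ [_ _ _ XV _]] _] := CP _ CX; exists X => //; exact: XV.
  - by move=> y [X CX Xy]; have [[_ [_ _ _ _ X0y]] _] := CP _ CX; exact: X0y.
have sfd := graph_dom_subfield sfK pg.
case: (pg) => gK [gQ gB gM gV g0].
have domQ x : Q x -> graph_dom g x.
  move=> Qx; apply: (Qx) => //; first by move=> z /FK/gK gz; exists z.
  move=> t [u gtu]; apply: contrapT => ndt.
  have [t' t'2] := sqrtOm u; rewrite -t'2 in gtu.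
  apply: (ndt); exists t'; apply: (gmax (extend_graph g t t')).
  - split; first exact: partial_graph_extend.
    exists s, (- s), 0, 0; rewrite !mul0r !addr0; split=> //.
    by apply: gK; exact: sf0.
  - move=> [x1 x2] gx; exists x1, x2, 0, 0; rewrite !mul0r !addr0; split=> //.
    by apply: gK; exact: sf0.
  - exists 0, 0, 1, 1; rewrite !mul1r !add0r.
    by split=> //; apply: gK; [exact: sf0 | exact: sf1].
have gfun x y y' : g (x, y) -> g (x, y') -> y = y'.
  by move=> gy gy'; apply/eqP; rewrite -subr_eq0; apply/eqP/g0; rewrite -(subrr x); exact: gB.
have [x|sigma sigmaP] := @choice _ _ (fun x y => Q x -> g (x, y)).
  (* Outside [Q] the value 0 is a mere default. *)
  by have [/domQ[y gy]|nQx] := pselect (Q x); [exists y | exists 0].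
exists sigma; last first.
  by apply: (gfun s) => //; apply: sigmaP; case: (gQ _ _ gs).
split.
- by move=> x Kx; apply: (gfun x); [by apply: sigmaP; exact: KQ | exact: gK].
- by move=> x /sigmaP/gQ[].
- by move=> x y Qx Qy; apply: (gfun (x - y)); [by apply: sigmaP; exact: (sfB sfQ) | apply: gB; exact: sigmaP].
- by move=> x y Qx Qy; apply: (gfun (x * y)); [by apply: sigmaP; exact: (sfM sfQ) | apply: gM; exact: sigmaP].
Qed.

(** * The monoid of embeddings: fixed fields, finite orbits, inverses *)

Lemma embedding_id K : embedding K id.
Proof. by split. Qed.

Lemma embedding_comp K sigma tau : embedding K sigma -> embedding K tau ->
  embedding K (sigma \o tau).
Proof.
move=> [sK sQ sB sM] [tK tQ tB tM]; split=> [x Kx|x Qx|x y Qx Qy|x y Qx Qy] /=.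
- by rewrite tK // sK.
- by apply: sQ; exact: tQ.
- by rewrite tB // sB //; exact: tQ.
- by rewrite tM // sM //; exact: tQ.
Qed.

Lemma embedding_sub K K' sigma : subfam K K' -> embedding K' sigma -> embedding K sigma.
Proof. by move=> KK' [sK sQ sB sM]; split=> // x /KK'; exact: sK. Qed.

Section Embedding.
Variable sigma : Om -> Om.
Hypothesis es : embedding F sigma.

Lemma embQ x : Q x -> Q (sigma x). Proof. by case: es => _ + _ _; apply. Qed.
Lemma embB x y : Q x -> Q y -> sigma (x - y) = sigma x - sigma y.
Proof. by case: es => _ _ + _; apply. Qed.
Lemma embM x y : Q x -> Q y -> sigma (x * y) = sigma x * sigma y.
Proof. by case: es => _ _ _; apply. Qed.
Lemma emb_id x : F x -> sigma x = x. Proof. by case: es => + _ _ _; apply. Qed.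
Lemma emb0 : sigma 0 = 0. Proof. by apply: emb_id; exact: sf0. Qed.
Lemma emb1 : sigma 1 = 1. Proof. by apply: emb_id; exact: sf1. Qed.
Lemma embN x : Q x -> sigma (- x) = - sigma x.
Proof. by move=> Qx; rewrite -sub0r embB //; [rewrite emb0 sub0r | exact: sf0 sfQ]. Qed.
Lemma embD x y : Q x -> Q y -> sigma (x + y) = sigma x + sigma y.
Proof. by move=> Qx Qy; rewrite -[y]opprK embB ?embN //; exact: (sfN sfQ). Qed.
Lemma embX x n : Q x -> sigma (x ^+ n) = sigma x ^+ n.
Proof.
move=> Qx; elim: n => [|n IHn]; first by rewrite !expr0 emb1.
by rewrite !exprS embM ?IHn //; exact: (sfX sfQ).
Qed.
Lemma emb_eq0 x : Q x -> sigma x = 0 -> x = 0.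
Proof.
move=> Qx sx0; apply/eqP; apply: contraT => nzx.
have := emb1; rewrite -(mulfV nzx) embM //; last exact: (sfV sfQ).
by rewrite sx0 mul0r mulfV // => /esym/eqP; rewrite oner_eq0.
Qed.
Lemma emb_inj x y : Q x -> Q y -> sigma x = sigma y -> x = y.
Proof.
move=> Qx Qy exy; apply/eqP; rewrite -subr_eq0; apply/eqP/emb_eq0.
  exact: (sfB sfQ).
by rewrite embB // exy subrr.
Qed.
Lemma embV x : Q x -> sigma x^-1 = (sigma x)^-1.
Proof.
move=> Qx; have [->|nzx] := eqVneq x 0; first by rewrite invr0 emb0 invr0.
have nzs : sigma x != 0 by apply: contra_neq nzx; exact: emb_eq0.
apply: (mulfI nzs); rewrite -(embM Qx (sfV sfQ Qx)).
by rewrite !mulfV // emb1.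
Qed.

Lemma emb_fixed_subfield : is_subfield (fun x => Q x /\ sigma x = x).
Proof.
split.
- by split; [exact: (sf0 sfQ) | exact: emb0].
- by split; [exact: (sf1 sfQ) | exact: emb1].
- by move=> x y [Qx xE] [Qy yE]; rewrite embB // xE yE; split=> //; exact: (sfB sfQ).
- by move=> x y [Qx xE] [Qy yE]; rewrite embM // xE yE; split=> //; exact: (sfM sfQ).
- by move=> x [Qx xE]; rewrite embV // xE; split=> //; exact: (sfV sfQ).
Qed.

Lemma emb_preim_subfield E : is_subfield E -> is_subfield (fun x => Q x /\ E (sigma x)).
Proof.
move=> sfE; split.
- by split; [exact: (sf0 sfQ) | rewrite emb0; exact: sf0].
- by split; [exact: (sf1 sfQ) | rewrite emb1; exact: sf1].
- by move=> x y [Qx xE] [Qy yE]; rewrite embB //; split; [exact: (sfB sfQ) | exact: sfB].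
- by move=> x y [Qx xE] [Qy yE]; rewrite embM //; split; [exact: (sfM sfQ) | exact: sfM].
- by move=> x [Qx xE]; rewrite embV //; split; [exact: (sfV sfQ) | exact: sfV].
Qed.

End Embedding.

(** Among the fields between [K] and [Q] avoiding [x], take a maximal [E]. As [x] is in [Q], some
    [t] outside [E] has its square in [E], and maximality gives [x = a + b * t]. The embedding over
    [E] with [t] sent to [- t] fixes [x], so [b * t = 0], a contradiction. *)
Lemma embedding_fixed K x : is_subfield K -> subfam F K -> subfam K Q -> Q x ->
  (forall sigma, embedding K sigma -> sigma x = x) -> K x.
Proof.
move=> sfK FK KQ Qx fixx; apply: contrapT => nKx.
have [C [X0 CX0] CP tot|E [sfE KE EQ nEx] Emax] :=
    @Zorn_from _ (fun E => [/\ is_subfield E, subfam K E, subfam E Q & ~ E x]) K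
      (And4 sfK (fun _ => id) KQ nKx).
  have common z w X Y : C X -> C Y -> X z -> Y w -> exists2 Z, C Z & Z z /\ Z w.
    move=> CX CY Xz Yw; have [XY|YX] := tot _ _ CX CY.
      by exists Y => //; split=> //; exact: XY.
    by exists X => //; split=> //; exact: YX.
  have [sfX0 X0K _ _] := CP _ CX0.
  split.
  - split.
    + by exists X0 => //; exact: sf0.
    + by exists X0 => //; exact: sf1.
    + move=> u v [X CX Xu] [Y CY Yv]; have [Z CZ [Zu Zv]] := common _ _ _ _ CX CY Xu Yv.
      by have [sfZ _ _ _] := CP _ CZ; exists Z => //; exact: sfB.
    + move=> u v [X CX Xu] [Y CY Yv]; have [Z CZ [Zu Zv]] := common _ _ _ _ CX CY Xu Yv.
      by have [sfZ _ _ _] := CP _ CZ; exists Z => //; exact: sfM.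
    + by move=> u [X CX Xu]; have [sfX _ _ _] := CP _ CX; exists X => //; exact: sfV.
  - by move=> u Ku; exists X0 => //; exact: X0K.
  - by move=> u [X CX Xu]; have [_ _ XQ _] := CP _ CX; exact: XQ.
  - by move=> [X CX Xx]; have [_ _ _] := CP _ CX; apply.
have FE : subfam F E by move=> z /FK/KE.
apply: (nEx); apply: (Qx) => // t Et2; apply: contrapT => nEt.
have Qt : Q t by apply: qclosure_sqrt_closed; exact: EQ.
have [a [b [Ea Eb xE]]] : sqrt_adjoin E t x.
  apply: contrapT => nx; apply: nEt; apply: (Emax (sqrt_adjoin E t)).
  - split=> //; first exact: sqrt_adjoin_subfield.
      by move=> z Kz; apply: sub_sqrt_adjoin => //; exact: KE.
    by move=> _ [a [b [/EQ Qa /EQ Qb ->]]]; exact: (sfD sfQ Qa (sfM sfQ Qb Qt)).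
  - exact: sub_sqrt_adjoin.
  - exact: mem_sqrt_adjoin.
have [sigma es st] := embedding_sqrtN sfE FE EQ Et2 nEt.
have := fixx _ (embedding_sub KE es).
have esF := embedding_sub FE es.
have [sE _ _ _] := es.
have Qa := EQ _ Ea; have Qb := EQ _ Eb.
rewrite xE (embD esF Qa (sfM sfQ Qb Qt)) (embM esF Qb Qt).
rewrite st !sE // => /eqP; rewrite -subr_eq0.
have -> : a + b * - t - (a + b * t) = - (2%:R * (b * t)) by ring.
rewrite oppr_eq0 !mulf_eq0 (negPf nz2) /= => /orP[/eqP b0|/eqP t0].
  by apply: nEx; rewrite xE b0 mul0r addr0.
by apply: nEt; rewrite t0; exact: sf0.
Qed.

(** Elements with a finite orbit form a subfield containing [F] and closed under square roots, hence
    exhaust [Q]. *)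
Lemma finite_orbit x : Q x ->
  exists l : seq Om, forall sigma, embedding F sigma -> sigma x \in l.
Proof.
move=> Qx0; pose fin x := exists l : seq Om, forall sigma, embedding F sigma -> sigma x \in l.
have [//] : Q x /\ fin x; apply: (Qx0 (fun x => Q x /\ fin x)).
- split.
  + by split; [exact: (sf0 sfQ) | exists [:: 0] => s es; rewrite emb0 ?mem_head].
  + by split; [exact: (sf1 sfQ) | exists [:: 1] => s es; rewrite emb1 ?mem_head].
  + move=> u v [Qu [l lP]] [Qv [m mP]]; split; first exact: (sfB sfQ).
    exists [seq p - q | p <- l, q <- m] => s es; rewrite (embB es) //.
    by apply: allpairs_f; [exact: lP | exact: mP].
  + move=> u v [Qu [l lP]] [Qv [m mP]]; split; first exact: (sfM sfQ).
    exists [seq p * q | p <- l, q <- m] => s es; rewrite (embM es) //.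
    by apply: allpairs_f; [exact: lP | exact: mP].
  + move=> u [Qu [l lP]]; split; first exact: (sfV sfQ).
    by exists [seq p^-1 | p <- l] => s es; rewrite (embV es) //; apply: map_f; exact: lP.
- move=> u Fu; split; first exact: sub_qclosure.
  by exists [:: u] => s es; rewrite (emb_id es) // mem_head.
- move=> u [Qu2 [l lP]]; have Qu := qclosure_sqrt_closed Qu2; split=> //.
  (* A conjugate of [u] squares to a conjugate of [u ^+ 2], so it is, up to sign, the root chosen by
     [r]. *)
  have [r rP] := choice sqrtOm.
  exists ([seq r p | p <- l] ++ [seq - r p | p <- l]) => s es.
  have /eqP : r (s (u ^+ 2)) ^+ 2 = s u ^+ 2 by rewrite rP (embX es).
  rewrite eqf_sqr mem_cat => /orP[/eqP <-|]; first by rewrite map_f ?lP.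
  by rewrite -eqr_oppLR => /eqP <-; rewrite (map_f (fun p => - r p)) ?lP // orbT.
Qed.

Lemma orbit_seq K x : subfam F K -> Q x ->
  exists2 O : seq Om, uniq O &
    forall v, v \in O <-> exists2 sigma, embedding K sigma & v = sigma x.
Proof.
move=> FK /finite_orbit[l lP].
exists (undup [seq v <- l | `[< exists2 sigma, embedding K sigma & v = sigma x >]]).
  exact: undup_uniq.
move=> v; rewrite mem_undup mem_filter; split; first by case/andP=> /asboolP.
move=> [sigma es ->]; apply/andP; split; first by apply/asboolP; exists sigma.
by apply: lP; exact: embedding_sub es.
Qed.

(** An injective map of a finite set into itself permutes it. *)
Lemma orbit_perm K x (O : seq Om) tau : subfam F K -> Q x -> uniq O ->
  (forall v, v \in O <-> exists2 sigma, embedding K sigma & v = sigma x) ->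
  embedding K tau -> perm_eq (map tau O) O.
Proof.
move=> FK Qx uO OP et.
have OQ v : v \in O -> Q v.
  by move=> /OP[sigma es ->]; apply: embQ => //; exact: embedding_sub es.
have uM : uniq (map tau O).
  rewrite map_inj_in_uniq // => u v /OQ Qu /OQ Qv.
  by apply: emb_inj => //; exact: embedding_sub et.
have sM : {subset map tau O <= O}.
  move=> _ /mapP[v /OP[sigma es ->] ->].
  by apply/OP; exists (tau \o sigma) => //; exact: embedding_comp.
have [_ eqM] := uniq_min_size uM sM (eq_leq (esym (size_map _ _))).
exact: uniq_perm.
Qed.

(** Surjectivity on [Q] holds orbit by orbit: [sigma] permutes the finite orbit of [x], which
    contains [x]. *)
Lemma embedding_inv sigma : embedding F sigma ->
  exists2 tau, embedding F tau &
    (forall x, Q x -> sigma (tau x) = x) /\ (forall x, Q x -> tau (sigma x) = x).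
Proof.
move=> es.
have surj x : Q x -> exists2 z, Q z & sigma z = x.
  move=> Qx; have [O uO OP] := @orbit_seq F x (fun _ => id) Qx.
  have : x \in map sigma O.
    rewrite (perm_mem (orbit_perm (fun _ => id) Qx uO OP es)).
    by apply/OP; exists id => //; exact: embedding_id.
  move=> /mapP[z /OP[rho er zE] xE]; exists z => //.
  by rewrite zE; exact: embQ.
have [x|tau tauP] := @choice _ _ (fun x z => Q x -> Q z /\ sigma z = x).
  by have [/surj[z Qz zx]|nQx] := pselect (Q x); [exists z | exists 0].
have tQ x : Q x -> Q (tau x) by move=> /tauP[].
have tK x : Q x -> sigma (tau x) = x by move=> /tauP[].
have tK' x : Q x -> tau (sigma x) = x.
  move=> Qx; have Qsx := embQ es Qx.
  by apply: (emb_inj es) => //; [exact: tQ | exact: tK].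
exists tau => //; split=> //.
- by move=> x Fx; rewrite -[in LHS](emb_id es Fx) tK' //; exact: sub_qclosure.
- move=> x y Qx Qy; rewrite -[in LHS](tK x) // -[in LHS](tK y) //.
  by rewrite -(embB es) ?tK' //; [apply: (sfB sfQ) | |]; exact: tQ.
- move=> x y Qx Qy; rewrite -[in LHS](tK x) // -[in LHS](tK y) //.
  by rewrite -(embM es) ?tK' //; [apply: (sfM sfQ) | |]; exact: tQ.
Qed.

(** * Galois extensions as stable subfields *)

Lemma emb_coef_prod sigma (O : seq Om) i : embedding F sigma ->
  (forall v, v \in O -> Q v) ->
  Q (\prod_(v <- O) ('X - v%:P))`_i /\
  sigma (\prod_(v <- O) ('X - v%:P))`_i = (\prod_(v <- map sigma O) ('X - v%:P))`_i.
Proof.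
move=> es; elim: O i => [|v O IHO] i OQ.
  rewrite /= !big_nil coef1; case: (i == 0%N).
    by split; [exact: (sf1 sfQ) | exact: emb1].
  by split; [exact: (sf0 sfQ) | exact: emb0].
have {}IHO j := IHO j (fun u Ou => OQ u (@mem_behead _ (v :: O) u Ou)).
have Qv := OQ v (mem_head v O).
rewrite /= !big_cons !mulrBl !coefB !coefXM !coefCM.
have [Qi si] := IHO i; have [Qi1 si1] := IHO i.-1.
(* [c] reads the coefficient of ['X * p] at [i]; the case [i = 0] is separate because [i.-1] is then
   again 0. *)
have [Q1 s1] : let c (p : {poly Om}) := if i == 0%N then 0 else p`_i.-1 in
    Q (c (\prod_(v <- O) ('X - v%:P))) /\
    sigma (c (\prod_(v <- O) ('X - v%:P))) = c (\prod_(v <- map sigma O) ('X - v%:P)).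
  by case: eqP => //= _; split; [exact: (sf0 sfQ) | exact: emb0].
split; first exact: (sfB sfQ Q1 (sfM sfQ Qv Qi)).
by rewrite (embB es Q1 (sfM sfQ Qv Qi)) s1 (embM es Qv Qi) si.
Qed.

Definition stable K E := forall sigma, embedding K sigma -> forall x, E x -> E (sigma x).

(** The witness for [x] is the product of ['X - v%:P] over the distinct conjugates [v] of [x]:
    embeddings permute its roots, so its coefficients are fixed and lie in [K]. *)
Lemma stable_galois K E : is_subfield K -> subfam F K -> is_subfield E ->
  subfam K E -> subfam E Q -> stable K E -> galois_over K E.
Proof.
move=> sfK FK sfE KE EQ stE; split=> // x Ex; have Qx := EQ _ Ex.
have KQ : subfam K Q by move=> z /KE/EQ.
have [O uO OP] := orbit_seq FK Qx.
have OQ v : v \in O -> Q v.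
  by move=> /OP[sigma es ->]; apply: embQ => //; exact: embedding_sub es.
exists (\prod_(v <- O) ('X - v%:P)); split.
- by rewrite monic_neq0 // monic_prod_XsubC.
- move=> i; apply: embedding_fixed => //.
    by case: (emb_coef_prod i (embedding_id F) OQ).
  move=> sigma es; have esF := embedding_sub FK es.
  have [_ ->] := emb_coef_prod i esF OQ.
  by rewrite (perm_big _ (orbit_perm FK Qx uO OP es)).
- by rewrite root_prod_XsubC; apply/OP; exists id => //; exact: embedding_id.
- by rewrite separable_prod_XsubC.
- exists O; split; first by move=> _ /OP[sigma es ->]; exact: stE.
  by rewrite (monicP (monic_prod_XsubC _ _ _)) scale1r.
Qed.

(** A conjugate of [x] is a root of the same polynomial over [K], and all roots of that polynomial
    lie in [E]. *)
Lemma galois_stable K E : subfam F K -> subfam K Q -> subfam E Q -> galois_over K E -> stable K E.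
Proof.
move=> FK KQ EQ [sfE KE galE] sigma es x Ex.
have Qx := EQ _ Ex; have esF := embedding_sub FK es; have [sK _ _ _] := es.
have [p [nzp pK /eqP px0 _ [rs [rsE pE]]]] := galE _ Ex.
apply: rsE; rewrite -root_prod_XsubC.
suff: root p (sigma x) by rewrite {1}pE rootZ // lead_coef_eq0.
apply/eqP; rewrite -(emb0 esF) -px0 !horner_coef.
elim: (size p) => [|n IHn]; first by rewrite !big_ord0 (emb0 esF).
have Qn i : Q (p`_i * x ^+ i) by apply: (sfM sfQ (KQ _ (pK i))); exact: (sfX sfQ).
have QS m : Q (\sum_(i < m) p`_i * x ^+ i).
  elim: m => [|m IHm]; first by rewrite big_ord0; exact: (sf0 sfQ).
  by rewrite big_ord_recr; exact: (sfD sfQ).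
rewrite !big_ord_recr /= (embD esF (QS n) (Qn n)) -IHn.
by rewrite (embM esF (KQ _ (pK n)) (sfX sfQ n Qx)) (embX esF _ Qx) (sK _ (pK n)).
Qed.

(** * Fields of a tower and one quadratic step *)

Lemma embedding_inv_over K sigma : subfam F K -> subfam K Q -> embedding K sigma ->
  exists2 tau, embedding K tau &
    (forall x, Q x -> sigma (tau x) = x) /\ (forall x, Q x -> tau (sigma x) = x).
Proof.
move=> FK KQ es; have [tau [_ tQ tB tM] [st ts]] := embedding_inv (embedding_sub FK es).
exists tau => //; split=> // x Kx; have [sK _ _ _] := es.
by rewrite -[in LHS](sK _ Kx) ts //; exact: KQ.
Qed.

(** Normality: since [K] is stable over [F], its embeddings are closed under conjugation by those of
    [F]. *)
Lemma embedding_conj K sigma tau rho : subfam F K -> subfam K Q -> stable F K ->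
  embedding F sigma -> embedding F tau -> (forall x, Q x -> tau (sigma x) = x) ->
  embedding K rho -> embedding K (tau \o (rho \o sigma)).
Proof.
move=> FK KQ stK es et ts er.
have [_ ? ? ?] := embedding_comp et (embedding_comp (embedding_sub FK er) es).
split=> // x Kx /=; have [rK _ _ _] := er.
by rewrite rK ?ts //; [exact: KQ | exact: stK].
Qed.

(* The Kummer form of "E(s) is Galois over K". *)
Definition kummer_stable K E s : Prop :=
  E (s ^+ 2) /\ forall sigma, embedding K sigma -> exists2 b, E b & sigma s = b * s.

(** Stability is asked over [F] rather than over [K], because the tower over [L] must stay normal
    over [F] to be compared with the tower over [F]. *)
Definition tower_field K E : Prop :=
  [/\ is_subfield E, subfam K E, subfam E Q & stable F E].

Section Step.
Variables K E : Om -> Prop.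
Hypotheses (fK : tower_field F K) (fE : tower_field K E).

Let sfK : is_subfield K. Proof. by case: fK. Qed.
Let FK : subfam F K. Proof. by case: fK. Qed.
Let KQ : subfam K Q. Proof. by case: fK. Qed.
Let sfE : is_subfield E. Proof. by case: fE. Qed.
Let KE : subfam K E. Proof. by case: fE. Qed.
Let EQ : subfam E Q. Proof. by case: fE. Qed.

Let stableE : stable K E.
Proof. by case: fE => _ _ _ stE sigma es; apply: stE; exact: embedding_sub es. Qed.

Lemma sub_qstep : subfam E (qstep K E).
Proof. by move=> x Ex; apply: sub_generated; left. Qed.

Lemma sqrt_in_qstep s : kummer_stable K E s -> qstep K E s.
Proof.
move=> [Es2 sP]; have [Es|nEs] := pselect (E s); first exact: sub_qstep.
have Qs := qclosure_sqrt_closed (EQ Es2).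
apply: sub_generated; right; exists (sqrt_adjoin E s); split.
- exact: quad_ext_sqrt_adjoin.
- apply: stable_galois => //.
  + exact: sqrt_adjoin_subfield.
  + by move=> x /KE; exact: sub_sqrt_adjoin.
  + by move=> _ [a [b [/EQ Qa /EQ Qb ->]]]; exact: (sfD sfQ Qa (sfM sfQ Qb Qs)).
  + move=> sigma es _ [a [b [Ea Eb ->]]]; have esF := embedding_sub FK es.
    have [c Ec sE] := sP _ es; have Qa := EQ Ea; have Qb := EQ Eb.
    exists (sigma a), (sigma b * c); split; first exact: stableE.
      by apply: sfM => //; exact: stableE.
    by rewrite (embD esF Qa (sfM sfQ Qb Qs)) (embM esF Qb Qs) sE mulrA.
- exact: mem_sqrt_adjoin.
Qed.

(** Converse to [sqrt_in_qstep]: a quadratic extension of [E] that is Galois over [K] is generated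
    by a Kummer stable root, so such roots generate the whole step. *)
Lemma qstep_min N : is_subfield N -> subfam E N ->
  (forall s, kummer_stable K E s -> N s) -> subfam (qstep K E) N.
Proof.
move=> sfN EN sN x; apply=> // {}x [/EN //|[E' [qE' galE' E'x]]].
have [sfE' EE' _] := qE'.
have [s [E's nEs Es2 E'P]] := quad_ext_sqrt nz2 sfE qE'.
have Qs := qclosure_sqrt_closed (EQ Es2).
have E'Q : subfam E' Q.
  by move=> _ /E'P[a [b [/EQ Qa /EQ Qb ->]]]; exact: (sfD sfQ Qa (sfM sfQ Qb Qs)).
suff ks : kummer_stable K E s.
  have [a [b [Ea Eb ->]]] := E'P _ E'x.
  by apply: sfD => //; [exact: EN | apply: sfM => //; [exact: EN | exact: sN]].
split=> // sigma es; have esF := embedding_sub FK es.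
have [a [b [Ea Eb sE]]] := E'P _ (galois_stable FK KQ E'Q galE' es E's).
(* For [b = 0] the image of [s] is in [E], and the inverse embedding brings [s] itself into [E]. *)
have [b0|nzb] := eqVneq b 0.
  have [tau et [_ ts]] := embedding_inv_over FK KQ es.
  by case: nEs; rewrite -(ts s Qs) sE b0 mul0r addr0; exact: stableE.
have [a0|nza] := eqVneq a 0; first by exists b => //; rewrite sE a0 add0r.
have nz2ab : 2%:R * a * b != 0 by rewrite !mulf_neq0.
(* The square of [a + b * s] equals [sigma (s ^+ 2)], an element of [E]; solving for the cross term
   puts [s] in [E]. *)
case: nEs; have -> : s = (sigma (s ^+ 2) - a ^+ 2 - b ^+ 2 * s ^+ 2) / (2%:R * a * b).
  by rewrite (embX esF) // sE; field; rewrite nz2 nza nzb.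
have E2 : E 2%:R by apply: sfD => //; exact: sf1.
apply: (sfM sfE); last by apply: sfV => //; exact: (sfM sfE (sfM sfE E2 Ea) Eb).
apply: (sfB sfE); last by apply: sfM => //; exact: sfX.
by apply: (sfB sfE); [exact: stableE | exact: sfX].
Qed.

Lemma tower_qstep : tower_field K (qstep K E).
Proof.
have sfS : is_subfield (qstep K E) by exact: generated_subfield.
split=> //; first by move=> x /KE; exact: sub_qstep.
  apply: qstep_min => [||s [/EQ Qs2 _]]; [exact: sfQ | exact: EQ |].
  exact: qclosure_sqrt_closed.
have [_ _ _ stK] := fK; have [_ _ _ stE] := fE.
(* Membership in [Q] joins the goal because the preimage of a subfield is known to be a subfield
   only within [Q]. *)
move=> sigma es x Sx; suff [] : Q x /\ qstep K E (sigma x) by [].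
apply: (@qstep_min (fun x => Q x /\ qstep K E (sigma x))) Sx.
- exact: emb_preim_subfield.
- by move=> z Ez; split; [exact: EQ | apply: sub_qstep; exact: stE].
- move=> s [Es2 sP]; have Qs := qclosure_sqrt_closed (EQ Es2); split=> //.
  apply: sqrt_in_qstep; split; first by rewrite -(embX es) //; exact: stE.
  move=> rho er; have [tau et [st ts]] := embedding_inv es.
  (* [sigma s] is again Kummer stable: conjugating [rho] by [sigma] gives an embedding over [K],
     which multiplies [s] by [b], so [rho] multiplies [sigma s] by [sigma b]. *)
  have [b Eb bE] := sP _ (embedding_conj FK KQ stK es et ts er).
  exists (sigma b); first exact: stE.
  rewrite -(embM es (EQ Eb) Qs) -bE /= st //.
  by apply: embQ; [exact: embedding_sub er | exact: embQ].
Qed.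

End Step.

Lemma tower_base : tower_field F F.
Proof. by split=> //; [exact: sub_qclosure | move=> s es x Fx; rewrite (emb_id es)]. Qed.

Lemma sqrt_base_qstep s : F (s ^+ 2) -> qstep F F s.
Proof.
move=> Fs2; apply: (sqrt_in_qstep tower_base tower_base); split=> // sigma es.
have Qs := qclosure_sqrt_closed (sub_qclosure Fs2).
have /eqP : sigma s ^+ 2 = s ^+ 2 by rewrite -(embX es) // (emb_id es).
rewrite eqf_sqr => /orP[] /eqP ->.
  by exists 1; [exact: sf1 | rewrite mul1r].
by exists (-1); [apply: sfN => //; exact: sf1 | rewrite mulN1r].
Qed.

(** * The quadratic extension [L] of [F] and its embeddings *)

Section Quadratic.
Variable y : Om.
Hypotheses (Fy2 : F (y ^+ 2)) (nFy : ~ F y).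

Local Notation L := (adjoin F y).

Lemma Qy : Q y. Proof. exact: qclosure_sqrt_closed (sub_qclosure Fy2). Qed.

Lemma sub_adjoin : subfam F L. Proof. by move=> x Fx; apply: sub_generated; left. Qed.

Lemma mem_adjoin : L y. Proof. by apply: sub_generated; right. Qed.

Lemma adjoin_min N : is_subfield N -> subfam F N -> N y -> subfam L N.
Proof. by move=> sfN FN Ny x; apply=> // z [/FN|->]. Qed.

Lemma emb_root sigma : embedding F sigma -> sigma y = y \/ sigma y = - y.
Proof.
move=> es; have /eqP : sigma y ^+ 2 = y ^+ 2 by rewrite -(embX es) ?(emb_id es) //; exact: Qy.
by rewrite eqf_sqr => /orP[] /eqP ->; [left | right].
Qed.

Lemma tower_adjoin : tower_field F L.
Proof.
have sfL : is_subfield L by exact: generated_subfield.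
split=> //; first exact: sub_adjoin.
  by apply: adjoin_min; [exact: sfQ | exact: sub_qclosure | exact: Qy].
move=> sigma es x Lx; suff [] : Q x /\ L (sigma x) by [].
apply: (@adjoin_min (fun x => Q x /\ L (sigma x))) Lx.
- exact: emb_preim_subfield.
- by move=> z Fz; split; [exact: sub_qclosure | rewrite (emb_id es) //; exact: sub_adjoin].
- split; first exact: Qy.
  by have [|] := emb_root es => ->; [exact: mem_adjoin | exact: (sfN sfL mem_adjoin)].
Qed.

Lemma embedding_adjoin sigma : embedding F sigma -> sigma y = y -> embedding L sigma.
Proof.
move=> es sy; have [_ ? ? ?] := es; split=> // x Lx.
suff [] : Q x /\ sigma x = x by [].
apply: (@adjoin_min (fun x => Q x /\ sigma x = x)) Lx.
- exact: emb_fixed_subfield.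
- by move=> z Fz; split; [exact: sub_qclosure | exact: emb_id].
- by split; first exact: Qy.
Qed.

Section Conjugate.
Variable tau : Om -> Om.
Hypotheses (et : embedding F tau) (ty : tau y = - y).

(** The embeddings over [L] have index 2, with [tau] in the other coset. That coset is described
    twice: [tau \o rho] computes images of [s], and [sigma \o tau] computes images of [tau s]. *)
Lemma coset_adjoin sigma : embedding F sigma ->
  embedding L sigma \/
  (exists2 rho, embedding L rho & forall x, Q x -> sigma x = tau (rho x)) /\
  embedding L (sigma \o tau).
Proof.
move=> es; have [/(embedding_adjoin es)|sy] := emb_root es; first by left.
right; split; last first.
  apply: embedding_adjoin => /=; first exact: embedding_comp.
  by rewrite ty (embN es Qy) sy opprK.
have [tau' et' [tK tK']] := embedding_inv et.
exists (tau' \o sigma); last by move=> x Qx /=; rewrite tK //; exact: embQ.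
apply: embedding_adjoin => /=; first exact: embedding_comp.
by rewrite sy -ty tK' //; exact: Qy.
Qed.

(** * Kummer generators over [L] and their conjugates *)

Section Kummer.
Variables (M : Om -> Prop) (s : Om).
Hypotheses (fM : tower_field L M) (ks : kummer_stable L M s).

Let MQ : subfam M Q. Proof. by case: fM. Qed.
Let stM : stable F M. Proof. by case: fM. Qed.
Let Qs : Q s. Proof. by case: ks => /MQ/qclosure_sqrt_closed. Qed.
Let Qts : Q (tau s). Proof. exact: embQ. Qed.

Lemma conj_kummer sigma : embedding F sigma ->
  exists b c, [/\ M b, M c &
    sigma s = b * s /\ sigma (tau s) = c * tau s \/
    sigma s = b * tau s /\ sigma (tau s) = c * s].
Proof.
move=> es; have [_ sP] := ks.
have [_ FL LQ stL] := tower_adjoin.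
have [eL|[[rho er rE] eL]] := coset_adjoin es.
  have [tau' et' [tK tK']] := embedding_inv et.
  have [b Mb bE] := sP _ eL.
  (* The conjugate of [sigma] by [tau] multiplies [s] by [c], so [sigma] multiplies [tau s] by
     [tau c]. *)
  have [c Mc cE] := sP _ (embedding_conj FL LQ stL et et' tK' eL).
  exists b, (tau c); split=> //; first exact: stM.
  left; split=> //; rewrite -(embM et (MQ Mc) Qs) -cE /= tK //.
  exact: embQ.
have [b Mb bE] := sP _ er; have [c Mc cE] := sP _ eL.
exists (tau b), c; split=> //; first exact: stM.
by right; split=> //; rewrite (rE _ Qs) bE (embM et (MQ Mb) Qs).
Qed.

Lemma kummer_norm_qstep E : tower_field F E -> subfam M E -> qstep F E (s * tau s).
Proof.
move=> fE ME; apply: (sqrt_in_qstep tower_base fE); have [sfE _ _ _] := fE.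
have [Ms2 _] := ks; split.
  rewrite exprMn -(embX et _ Qs); apply: sfM => //; apply: ME => //; exact: stM.
move=> sigma es; have [b [c [Mb Mc bcE]]] := conj_kummer es.
exists (b * c); first by apply: sfM => //; exact: ME.
(* Whether or not [sigma] exchanges the lines of [s] and [tau s], their product is multiplied by
   [b * c]. *)
by rewrite (embM es Qs Qts); case: bcE => -[-> ->]; ring.
Qed.

Lemma kummer_qstep E : tower_field F E -> subfam M E -> E (s * tau s) -> qstep F E s.
Proof.
move=> fE ME Ew; have [sfE _ _ _] := fE; have [Ms2 _] := ks.
apply: (sqrt_in_qstep tower_base fE); split; first exact: ME.
move=> sigma es; have [b [c [/ME Eb _ [[sE _]|[sE _]]]]] := conj_kummer es.
  by exists b.
(* In the exchanging case [tau s] is rewritten as [(s * tau s / s ^+ 2) * s], with the first factor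
   in [E]. *)
exists (b * (s * tau s / s ^+ 2)).
  by apply: (sfM sfE Eb); apply: (sfM sfE Ew); apply: sfV => //; exact: ME.
rewrite sE; have [->|nzs] := eqVneq s 0; first by rewrite (emb0 et) !mulr0.
by field.
Qed.

End Kummer.

(** The norm from [L] to [F]: embeddings over [L] fix both factors, the others exchange them. *)
Lemma norm_base u : L u -> F (u * tau u).
Proof.
move=> Lu; have [_ _ LQ stL] := tower_adjoin.
have Qu := LQ _ Lu; have Ltu := stL _ et _ Lu; have Qtu := LQ _ Ltu.
apply: embedding_fixed => //; [exact: sub_qclosure | exact: (sfM sfQ) |].
move=> sigma es; rewrite (embM es Qu Qtu).
have [[sL _ _ _]|[[rho [rL _ _ _] rE] [sL _ _ _]]] := coset_adjoin es.
  by rewrite !sL.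
by rewrite (rE _ Qu) rL // -[sigma (tau u)]/((sigma \o tau) u) sL // mulrC.
Qed.

End Conjugate.

(** * Comparison of the towers over [L] and over [F] *)

Lemma kpow_adjoin_sub : subfam (kpow L 3) (kpow F 5).
Proof.
have fL := tower_adjoin; have [sfL FL LQ stL] := fL.
have fLL : tower_field L L by split.
have fF2 := tower_qstep tower_base tower_base.
have fF3 := tower_qstep tower_base fF2.
have fF4 := tower_qstep tower_base fF3.
have [sfF2 FF2 _ _] := fF2; have [sfF3 _ _ _] := fF3; have [sfF4 _ _ _] := fF4.
have [sfF5 _ _ _] := tower_qstep tower_base fF4.
have [tau et ty] := embedding_sqrtN sfF (fun _ => id) sub_qclosure Fy2 nFy.
have LF2 : subfam L (qstep F F) by apply: adjoin_min => //; exact: sqrt_base_qstep.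
have L2F3 : subfam (qstep L L) (qstep F (qstep F F)).
  apply: (qstep_min fL fLL) => //; first by move=> x /LF2; exact: sub_qstep.
  move=> s ks; have [Ls2 _] := ks.
  (* Here [s * tau s] squares to the norm of [s ^+ 2], so it is already in [F^(2)] and [s] is in
     [F^(3)]. *)
  apply: (kummer_qstep et ty fLL ks fF2 LF2); apply: sqrt_base_qstep.
  rewrite exprMn -(embX et); first exact: norm_base.
  exact: qclosure_sqrt_closed (LQ _ Ls2).
apply: (qstep_min fL (tower_qstep fL fLL)) => //.
  by move=> x /L2F3 ?; do 2!apply: sub_qstep.
(* At the second level [s ^+ 2] is only known in [F^(3)]: the product [s * tau s] costs one step, to
   [F^(4)], and [s] another, to [F^(5)]. *)
move=> s ks; have fL2 := tower_qstep fL fLL.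
apply: (kummer_qstep et ty fL2 ks fF4); first by move=> x /L2F3; exact: sub_qstep.
exact: (kummer_norm_qstep et ty fL2 ks fF3).
Qed.

End Quadratic.

(** * Normality of the tower over [F] and the inclusion of the Galois closure *)

Lemma kpow_galois n : galois_over F (kpow F n).
Proof.
suff [sfE FE EQ stE] : tower_field F (kpow F n) by exact: stable_galois.
rewrite /kpow; elim: n.-1 => [|m IHm]; first exact: tower_base.
exact: (tower_qstep tower_base IHm).
Qed.

End QuadraticClosure.

Theorem theorem2 (Om : fieldType) (F : Om -> Prop) (a y : Om) :
  (2%:R : Om) != 0 ->
  (forall x : Om, exists z : Om, z ^+ 2 = x) ->
  is_subfield F ->
  F a -> a != 0 -> ~ (exists b, F b /\ b ^+ 2 = a) ->
  y ^+ 2 = a ->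
  subfam (gal_closure F (kpow (adjoin F y) 3)) (kpow F 5).
Proof.
(* The closure is an intersection of Galois extensions of [F], so it suffices that [F^(5)] is one of
   them. *)
move=> nz2 sqrtOm sfF Fa _ nsqa y2 x; apply; last exact: kpow_galois.
apply: kpow_adjoin_sub => //; first by rewrite y2.
by move=> Fy; apply: nsqa; exists y.
Qed.
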